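(* Let $q$ be a prime power, $m,n,k$ positive integers and $\rho\in\{1,\ldots,\min\{k,m\}\}$. Let $\mathcal{U}$ be a rank-$\rho$-saturating $[n,k]_{q^m/q}$ system. Then \[\begin{bmatrix} n\\ \rho\end{bmatrix}_q\ge q^{m(k-\rho)}.\] In particular, $n\ge \lceil mk/\rho\rceil-m+\rho$ if $q>2$; $n\ge \lceil (mk-1)/\rho\rceil-m+\rho$ if $q=2$ and $\rho>1$; and $n\ge m(k-1)+1$ if $q=2$ and $\rho=1$.
   Context: $\begin{bmatrix} a\\ b\end{bmatrix}_q=\prod_{j=0}^{b-1}\frac{q^a-q^j}{q^b-q^j}$ is the Gaussian binomial coefficient. An $[n,k]_{q^m/q}$ system is an $n$-dimensional $\mathbb{F}_q$-subspace $\mathcal{U}\le\mathbb{F}_{q^m}^k$ with $\langle\mathcal{U}\rangle_{\mathbb{F}_{q^m}}=\mathbb{F}_{q^m}^k$; its linear set is $L_\mathcal{U}=\{\langle u\rangle_{\mathbb{F}_{q^m}}:u\in\mathcal{U}\setminus\{0\}\}\subseteq\mathrm{PG}(k-1,q^m)$. A point set $\mathcal{S}$ of $\mathrm{PG}(k-1,q^m)$ is $r$-saturating if every point lies in the projective subspace spanned by some $r+1$ points of $\mathcal{S}$ and $r$ is minimal with this property; $\mathcal{U}$ is rank-$\rho$-saturating if $L_\mathcal{U}$ is $(\rho-1)$-saturating. *)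

(* Defs.v *)
From HB Require Import structures.
From mathcomp Require Import all_boot all_order all_algebra all_field.
Set Implicit Arguments.
Unset Strict Implicit.
Unset Printing Implicit Defensive.
Import Order.TTheory GRing.Theory Num.Theory.
Local Open Scope ring_scope.

Definition gauss_binom (q a b : nat) : rat :=
  \prod_(j < b) ((q%:R ^+ a - q%:R ^+ j) / (q%:R ^+ b - q%:R ^+ j)).

(* Throughout, F is the field with q elements and L its extension of degree m.
   The space L^k occurs with two scalar fields: F-subspaces are taken in
   {ffun 'I_k -> L}, a vectType over F, and L-subspaces in 'rV[L]_k, a vectType
   over L; to_row identifies the two. *)
Definition to_row (F : finFieldType) (L : fieldExtType F) (k : nat)
    (u : {ffun 'I_k -> L}) : 'rV[L]_k :=
  \row_i u i.

(* <U>_L = L^k: the only L-subspace containing U is the whole space. *)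
Definition q_system (F : finFieldType) (L : fieldExtType F) (n k : nat)
    (U : {vspace {ffun 'I_k -> L}}) : Prop :=
  \dim U = n /\
  (forall W : {vspace 'rV[L]_k},
     (forall u, u \in U -> to_row u \in W) -> W = fullv).

(* PG(k-1, L), its points being the L-lines of L^k. *)
Definition pg_point (L : fieldType) (k : nat) : Type :=
  {P : {vspace 'rV[L]_k} | \dim P == 1%N}.

Definition linear_set (F : finFieldType) (L : fieldExtType F) (k : nat)
    (U : {vspace {ffun 'I_k -> L}}) (P : pg_point L k) : Prop :=
  exists u : {ffun 'I_k -> L}, [/\ u \in U, u != 0 & sval P = <[to_row u]>%VS].

Definition spanned_by_points (L : fieldType) (k : nat)
    (S : pg_point L k -> Prop) (r : nat) : Prop :=
  forall P : pg_point L k,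
    exists Q : 'I_r.+1 -> pg_point L k,
      [/\ injective Q, forall i, S (Q i)
        & (sval P <= \sum_(i < r.+1) sval (Q i))%VS].

Definition saturating (L : fieldType) (k : nat)
    (S : pg_point L k -> Prop) (r : nat) : Prop :=
  spanned_by_points S r /\
  (forall s : nat, (s < r)%N -> ~ spanned_by_points S s).

(* Meant for rho >= 1 only, because of the truncated predecessor. *)
Definition rank_saturating (F : finFieldType) (L : fieldExtType F) (k : nat)
    (U : {vspace {ffun 'I_k -> L}}) (rho : nat) : Prop :=
  saturating (linear_set U) rho.-1.

(* Main.v *)
(** Every vector of L^k lies in the L-span of r = rho vectors of U, hence in the
    L-span of some r-dimensional F-subspace of U. There are [n, r]_q such
    subspaces and each of these spans has at most q^(mr) elements, so that
    q^(mk) <= [n, r]_q q^(mr). The bounds on n follow from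
    [n, r]_q <= q^(r(n-r)) / prod_{i <= r} (1 - q^-i), the last product being
    larger than 1 - q^-1 - q^-2, which is at least 1/q for q > 2 and equals 1/4
    for q = 2. For q = 2 and r = 1 this loses too much, and the exact value
    [n, 1]_2 = 2^n - 1 is used instead. *)

Require Import Defs.
From mathcomp Require Import all_boot all_order all_algebra all_field.
From mathcomp Require Import mxabelem zify ring lra.
Import Order.TTheory GRing.Theory Num.Theory.
Local Open Scope ring_scope.

Set Implicit Arguments.
Unset Strict Implicit.

Lemma row_free_col_mx (K : fieldType) (r n : nat) (v : 'rV[K]_n)
    (M : 'M[K]_(r, n)) :
  row_free (col_mx v M) = row_free M && ~~ (v <= M)%MS.
Proof.
rewrite -!row_leq_rank -addsmxE.
have [vM | nvM] := boolP (v <= M)%MS.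
  by rewrite (addsmx_idPr vM) andbF leqNgt ltnS rank_leq_row.
have lt_rank : (\rank M < \rank (v + M)%MS)%N.
  have : (M < v + M)%MS by rewrite ltmxE addsmxSr addsmx_sub submx_refl andbT.
  by rewrite ltmxErank => /andP[].
have le_rank := (mxrank_adds_leqif v M).1; have le_v1 := rank_leq_row v.
by rewrite andbT; apply/idP/idP; lia.
Qed.

Lemma exists_supmx_rank (K : fieldType) (m n r : nat) (A : 'M[K]_(m, n)) :
  (\rank A <= r <= n)%N -> exists2 W : 'M[K]_n, \rank W = r & (A <= W)%MS.
Proof.
case/andP=> le_Ar le_rn; exists (pid_mx r *m row_ebase A).
  by rewrite mxrankMfree ?rank_pid_mx // row_free_unit row_ebase_unit.
apply/submxP; exists (col_ebase A *m pid_mx (\rank A)).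
rewrite mulmxA -(mulmxA (col_ebase A)) mul_pid_mx.
have -> : minn n (minn (\rank A) r) = \rank A by lia.
by rewrite mulmx_ebase.
Qed.

Lemma card_rV (T : finType) (n : nat) : #|'rV[T]_n| = (#|T| ^ n)%N.
Proof. by rewrite card_mx mul1n. Qed.

(* The truncated subtractions are harmless: for n < r both products have a zero
   factor. *)
Lemma natr_prod_subX (R : comPzRingType) (q n r : nat) : (0 < q)%N ->
  (\prod_(j < r) (q ^ n - q ^ j))%N%:R
    = \prod_(j < r) (q%:R ^+ n - q%:R ^+ j) :> R.
Proof.
move=> q_gt0; have [le_rn | lt_nr] := leqP r n.
  rewrite natr_prod; apply: eq_bigr => j _.
  by rewrite natrB ?natrX // leq_pexp2l // ltnW // (leq_trans _ le_rn).
by rewrite 2!(bigD1 (Ordinal lt_nr) isT) /= subnn mul0n subrr mul0r.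
Qed.

Section Grassmannian.

Variable F : finFieldType.
Implicit Types r n : nat.

(* A subspace of F^n is represented by the canonical matrix <<W>> of its row
   space. *)
Definition grassmannian n r : {set 'M[F]_n} :=
  [set W | (<<W>>%MS == W) && (\rank W == r)].

Lemma genmx_grassmannian (m n : nat) (A : 'M[F]_(m, n)) :
  <<A>>%MS \in grassmannian n (\rank A).
Proof. by rewrite inE genmx_id mxrank_gen !eqxx. Qed.

Lemma card_row_free r n :
  #|[set M : 'M[F]_(r, n) | row_free M]|
    = (\prod_(j < r) (#|F| ^ n - #|F| ^ j))%N.
Proof.
elim: r => [|r IHr].
  rewrite big_ord0; apply/eqP/cards1P; exists 0; apply/setP=> M.
  by rewrite !inE -row_leq_rank [M]flatmx0 eqxx.
rewrite big_ord_recr /= -{}IHr -sum_nat_const -sum1dep_card.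
pose stack (p : 'M[F]_(r, n) * 'rV[F]_n) : 'M[F]_(1 + r, n) := col_mx p.2 p.1.
rewrite (reindex stack) /=; last first.
  exists (fun M : 'M_(1 + r, n) => (dsubmx M, usubmx M)) => [[M v] _ | M _] /=.
    by rewrite /stack col_mxKu col_mxKd.
  exact: vsubmxK.
under eq_bigl => p do rewrite row_free_col_mx.
rewrite -(pair_big_dep (fun M => row_free M) (fun M v => ~~ (v <= M)%MS)
            (fun _ _ => 1%N)) /=.
apply: eq_big => [M | M freeM]; first by rewrite inE.
have card_span : #|rowg M| = (#|F| ^ r)%N by rewrite card_rowg (eqP freeM).
rewrite sum1dep_card -card_rV -card_span -(cardsC (rowg M)) addKn.
by apply: eq_card => v; rewrite !inE.
Qed.

Lemma card_eqmx_row_free r n (B : 'M[F]_(r, n)) : row_free B ->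
  #|[set M : 'M[F]_(r, n) | (M == B)%MS]| = #|[set P : 'M[F]_r | row_free P]|.
Proof.
move=> freeB; rewrite -(card_imset _ (row_free_inj freeB)).
apply: eq_card => M; rewrite inE; apply/idP/imsetP => [eqMB | [P]].
  have /andP[/submxP[P defM] _] := eqMB; exists P => //.
  rewrite inE -row_leq_rank -(mxrankMfree _ freeB) -defM.
  by rewrite (eqmxP eqMB) row_leq_rank.
rewrite inE row_free_unit -row_full_unit => fullP ->.
by apply/eqmxP/eqmxMfull.
Qed.

Lemma card_row_free_grassmannian r n :
  #|[set M : 'M[F]_(r, n) | row_free M]|
    = (#|grassmannian n r| * #|[set P : 'M[F]_r | row_free P]|)%N.
Proof.
rewrite -sum1_card (partition_big (fun M : 'M[F]_(r, n) => <<M>>%MS)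
  [in grassmannian n r]) /= => [|M]; last first.
  by rewrite inE => /eqP {2}<-; apply: genmx_grassmannian.
rewrite -sum_nat_const; apply: eq_bigr => W.
rewrite inE => /andP[/eqP genW /eqP rankW].
rewrite sum1dep_card; case: r / rankW.
rewrite -(card_eqmx_row_free (row_base_free W)); apply: eq_card => M.
rewrite !inE -[X in _ == X]genW.
apply/andP/eqmxP => [[_ /eqP/genmxP/eqmxP eqMW] | eqMB].
  exact: eqmx_trans eqMW (eqmx_sym (eq_row_base W)).
have eqMW := eqmx_trans eqMB (eq_row_base W).
by rewrite -row_leq_rank eqMW (eq_genmx eqMW).
Qed.

Lemma card_grassmannian r n :
  #|grassmannian n r|%:R = gauss_binom #|F| n r.
Proof.
have q_gt1 : (1 < #|F|)%N := finNzRing_gt1 F.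
rewrite /gauss_binom prodf_div -!natr_prod_subX ?(ltnW q_gt1) //.
rewrite -!card_row_free card_row_free_grassmannian natrM mulfK //.
rewrite pnatr_eq0 card_row_free -lt0n.
by apply: prodn_gt0 => j; rewrite subn_gt0 ltn_exp2l.
Qed.

Lemma card_grassmannian_cover (L : finFieldType) (f : {rmorphism F -> L})
    (r n k : nat) (B : 'M[L]_(n, k)) :
  (forall v : 'rV[L]_k,
     exists2 W, W \in grassmannian n r & (v <= map_mx f W *m B)%MS) ->
  (#|L| ^ k <= #|grassmannian n r| * #|L| ^ r)%N.
Proof.
move=> cover_v.
pose span_of (W : 'M[F]_n) := rowg (map_mx f W *m B).
have cover_all : [set: 'rV[L]_k] \subset cover (span_of @: grassmannian n r).
  apply/subsetP=> v _; have [W grW vW] := cover_v v.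
  by apply/bigcupP; exists (span_of W); rewrite ?imset_f // inE.
rewrite -card_rV -cardsT (leq_trans (subset_leq_card cover_all)) //.
rewrite (leq_trans (leq_card_cover _).1) //.
apply: (@leq_trans (#|span_of @: grassmannian n r| * #|L| ^ r)); last first.
  by rewrite leq_mul2r leq_imset_card orbT.
rewrite -sum_nat_const; apply: leq_sum => _ /imsetP[W grW ->].
move: grW; rewrite inE => /andP[_ /eqP <-].
rewrite card_rowg leq_exp2l ?finNzRing_gt1 //.
by rewrite -(mxrank_map f W) mxrankM_maxl.
Qed.

End Grassmannian.

Section LinearSets.

Variables (F : finFieldType) (L : fieldExtType F) (k : nat).
Variable U : {vspace {ffun 'I_k -> L}}.

Definition basis_mx : 'M[L]_(\dim U, k) := \matrix_i to_row (vbasis U)`_i.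

Definition coord_row (u : {ffun 'I_k -> L}) : 'rV[F]_(\dim U) :=
  \row_i coord (vbasis U) i u.

Lemma to_row_coord (u : {ffun 'I_k -> L}) : u \in U ->
  to_row u = map_mx (in_alg L) (coord_row u) *m basis_mx.
Proof.
move=> Uu; apply/rowP=> j; rewrite !mxE {1}(coord_vbasis Uu) sum_ffunE.
by apply: eq_bigr => i _; rewrite !mxE ffunE mulr_algl.
Qed.

Lemma q_system_leq (n : nat) : q_system n U -> (k <= n)%N.
Proof.
case=> <- spanU.
pose X := [seq row i basis_mx | i <- enum 'I_(\dim U)].
have fullX : <<X>>%VS = fullv.
  apply: spanU => u Uu; rewrite (to_row_coord Uu) mulmx_sum_row.
  apply: memv_suml => i _; apply/memvZ/memv_span/map_f.
  by rewrite mem_enum.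
have := dim_span X; rewrite fullX size_map size_enum_ord.
by rewrite dimvf /dim /= mul1n.
Qed.

Lemma spanned_by_points_sum (r : nat) (v : 'rV[L]_k) :
  spanned_by_points (linear_set U) r ->
  exists (u : 'I_r.+1 -> {ffun 'I_k -> L}) (a : 'I_r.+1 -> L),
    (forall i, u i \in U) /\ v = \sum_i a i *: to_row (u i).
Proof.
move=> spanU; have [-> | v_neq0] := eqVneq v 0.
  exists (fun=> 0), (fun=> 0); split=> [i|]; first exact: mem0v.
  by rewrite big1 // => i _; rewrite scale0r.
have dim_v : \dim <[v]> == 1%N by rewrite dim_vline v_neq0.
have [Q [_ Q_U]] := spanU (exist _ <[v]>%VS dim_v).
rewrite -memvE => /memv_sumP[x x_Q ->].
have /fin_all_exists2[u Uu /fin_all_exists[a x_a]] i :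
    exists2 u, u \in U & exists a, x i = a *: to_row u.
  have [u [Uu _ Qi]] := Q_U i; have := x_Q i isT; rewrite Qi => /vlineP[a ->].
  by exists u => //; exists a.
by exists u, a; split=> //; apply: eq_bigr => i _; apply: x_a.
Qed.

Lemma spanned_by_points_cover (r : nat) (v : 'rV[L]_k) :
  (r < \dim U)%N -> spanned_by_points (linear_set U) r ->
  exists2 W, W \in grassmannian F (\dim U) r.+1
    & (v <= map_mx (in_alg L) W *m basis_mx)%MS.
Proof.
move=> lt_rU /(spanned_by_points_sum v)[u [a [Uu ->]]].
pose A := \matrix_i coord_row (u i).
have rank_A : (\rank A <= r.+1 <= \dim U)%N by rewrite rank_leq_row.
have [W rankW AW] := exists_supmx_rank rank_A.
exists <<W>>%MS; first by rewrite -rankW genmx_grassmannian.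
apply: summx_sub => i _; rewrite scalemx_sub // to_row_coord //.
have := submx_trans (row_sub i A) AW; rewrite rowK => uW.
by rewrite submxMr // map_submx genmxE.
Qed.

Lemma spanned_by_points_gauss_binom_ge (r : nat) : (r < k <= \dim U)%N ->
  spanned_by_points (linear_set U) r ->
  (#|F| ^ (\dim {:L} * (k - r.+1)))%:R <= gauss_binom #|F| (\dim U) r.+1.
Proof.
case/andP=> lt_rk le_kU spanU.
have := @card_grassmannian_cover F (finvect_type L) (in_alg (finvect_type L))
  r.+1 (\dim U) k basis_mx.
have cardL : #|finvect_type L| = (#|F| ^ \dim {:L})%N.
  by rewrite -(card_vspacef (Vector.class (finvect_type L))) card_vspace.
have cover v := spanned_by_points_cover v (leq_trans lt_rk le_kU) spanU.
move=> /(_ cover); rewrite cardL -!expnM -{1}(subnK lt_rk) mulnDr expnD.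
rewrite leq_pmul2r ?expn_gt0 ?(ltnW (finNzRing_gt1 F)) //.
by rewrite -card_grassmannian ler_nat.
Qed.

End LinearSets.

Lemma prodr_subX (K : fieldType) (x : K) (r : nat) : x != 0 ->
  \prod_(j < r) (x ^+ r - x ^+ j)
    = x ^+ (r * r) * \prod_(j < r) (1 - x^-1 ^+ j.+1).
Proof.
move=> x_neq0; rewrite exprM -[X in _ ^+ X * _]card_ord -prodr_const.
rewrite -big_split /= (reindex_inj rev_ord_inj) /=; apply: eq_bigr => j _.
by rewrite mulrBr mulr1 exprVn exprB ?unitfE.
Qed.

Lemma prodr_subX_le (R : numDomainType) (x : R) (n r : nat) :
  1 <= x -> (r <= n)%N ->
  \prod_(j < r) (x ^+ n - x ^+ j) <= x ^+ (n * r).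
Proof.
move=> x_ge1 le_rn; have x_ge0 : 0 <= x := le_trans ler01 x_ge1.
rewrite exprM -[X in _ <= _ ^+ X]card_ord -prodr_const.
apply: ler_prod => j _; rewrite subr_ge0 ler_weXn2l //; last first.
  exact: ltnW (leq_trans (ltn_ord j) le_rn).
by rewrite gerBl exprn_ge0.
Qed.

(* The first terms of Euler's pentagonal number expansion; the extra power makes
   the induction go through. *)
Lemma prodr_1subX_ge (R : realFieldType) (x : R) (r : nat) :
  0 <= x <= 1 ->
  1 - x - x ^+ 2 + x ^+ r.+1 <= \prod_(j < r) (1 - x ^+ j.+1).
Proof.
case/andP=> x_ge0 x_le1; have x2_ge0 := sqr_ge0 x.
case: r => [|r]; first by rewrite big_ord0 expr1; lra.
elim: r => [|r IHr]; first by rewrite big_ord1 expr1; lra.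
rewrite big_ord_recr /=; set y := x ^+ r.+2 in IHr *.
have y_ge0 : 0 <= y by apply: exprn_ge0.
have y_le1 : y <= 1 by apply: exprn_ile1.
have y_lex2 : y <= x ^+ 2 by apply: ler_wiXn2l.
apply: le_trans (ler_wpM2r _ IHr); last by rewrite subr_ge0.
rewrite exprS -/y -subr_ge0.
have -> : (1 - x - x ^+ 2 + y) * (1 - y) - (1 - x - x ^+ 2 + x * y)
    = y * (x ^+ 2 - y) by ring.
by rewrite mulr_ge0 ?subr_ge0.
Qed.

Lemma gauss_binom_le (q n r : nat) : (1 < q)%N -> (r <= n)%N ->
  gauss_binom q n r
    <= q%:R ^+ (r * (n - r)) / \prod_(j < r) (1 - q%:R^-1 ^+ j.+1).
Proof.
move=> q_gt1 le_rn; have q_gt0 : 0 < q%:R :> rat by rewrite ltr0n ltnW.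
rewrite /gauss_binom prodf_div prodr_subX ?gt_eqF // invfM mulrA.
apply: ler_wpM2r.
  rewrite invr_ge0 prodr_ge0 // => j _.
  by rewrite subr_ge0 exprVn invf_le1 ?exprn_gt0 // exprn_ege1 // ler1n ltnW.
rewrite ler_pdivrMr ?exprn_gt0 // -exprD -mulnDr subnK // mulnC.
by rewrite prodr_subX_le // ler1n ltnW.
Qed.

Lemma gauss_binom_lt (q n r c : nat) : (1 < q)%N -> (r <= n)%N ->
  q%:R ^- c <= 1 - q%:R^-1 - q%:R ^- 2 :> rat ->
  gauss_binom q n r < q%:R ^+ (r * (n - r) + c).
Proof.
move=> q_gt1 le_rn qc; have q_gt0 : 0 < q%:R :> rat by rewrite ltr0n ltnW.
have lt_prod : q%:R ^- c < \prod_(j < r) (1 - q%:R^-1 ^+ j.+1) :> rat.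
  apply: lt_le_trans (prodr_1subX_ge r _); last first.
    by rewrite invr_ge0 ltW //= invf_le1 // ler1n ltnW.
  by rewrite exprVn (le_lt_trans qc) // ltrDl exprVn invr_gt0 exprn_gt0.
apply: le_lt_trans (gauss_binom_le q_gt1 le_rn) _.
rewrite exprD ltr_pM2l ?exprn_gt0 // -[ltRHS]invrK ltf_pV2 // posrE.
  by apply: lt_trans lt_prod; rewrite invr_gt0 exprn_gt0.
by rewrite invr_gt0 exprn_gt0.
Qed.

Lemma gauss_binom_gt2_lt (q n r : nat) : (2 < q)%N -> (r <= n)%N ->
  gauss_binom q n r < q%:R ^+ (r * (n - r) + 1).
Proof.
move=> q_gt2 le_rn; apply: gauss_binom_lt => //; first exact: ltnW.
have : 3 <= q%:R :> rat by rewrite ler_nat.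
set x : rat := q%:R => x_ge3; have x_gt0 : 0 < x by lra.
rewrite expr1 -subr_ge0.
have -> : 1 - x^-1 - x ^- 2 - x^-1 = (x ^+ 2 - 2 * x - 1) / x ^+ 2.
  by field; rewrite gt_eqF.
by rewrite divr_ge0 ?exprn_ge0 ?(ltW x_gt0) //; nra.
Qed.

Lemma gauss_binom2_lt (n r : nat) : (r <= n)%N ->
  gauss_binom 2 n r < 2%:R ^+ (r * (n - r) + 2).
Proof. by move=> le_rn; apply: (gauss_binom_lt (c := 2) _ le_rn); [|lra]. Qed.

Lemma gauss_binom1 (q n : nat) :
  gauss_binom q n 1 = (q%:R ^+ n - 1) / (q%:R - 1).
Proof. by rewrite /gauss_binom big_ord1 !expr0 expr1. Qed.

Lemma ceil_divr_natr_le (R : archiRealFieldType) (x : R) (d a : nat) :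
  (0 < d)%N -> (Num.ceil (x / d%:R) <= a%:Z) = (x <= (d * a)%:R).
Proof.
move=> d_gt0.
by rewrite ceil_le_int -pmulrn ler_pdivrMr ?ltr0n // -natrM mulnC.
Qed.

Unset Implicit Arguments.

Theorem theorem3p3 (q m n k rho : nat)
    (F : finFieldType) (L : fieldExtType F) (U : {vspace {ffun 'I_k -> L}})
    (hq : #|F| = q) (hm : \dim {:L} = m)
    (m_gt0 : (0 < m)%N) (n_gt0 : (0 < n)%N) (k_gt0 : (0 < k)%N)
    (hrho : (1 <= rho <= minn k m)%N)
    (hU : q_system n U) (hsat : rank_saturating U rho) :
  [/\ (q ^ (m * (k - rho)))%:R <= gauss_binom q n rho,
      ((2 < q)%N ->
         Num.ceil ((m * k)%:R / rho%:R : rat) - m%:Z + rho%:Z <= n%:Z),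
      (q = 2%N -> (1 < rho)%N ->
         Num.ceil (((m * k)%:R - 1) / rho%:R : rat) - m%:Z + rho%:Z <= n%:Z)
    & (q = 2%N -> rho = 1%N -> (m * (k - 1) + 1 <= n)%N)].
Proof.
have [dimU _] := hU; have le_kn := q_system_leq hU.
have [rho_gt0 le_rk le_rn] : [/\ 0 < rho, rho <= k & rho <= n]%N by split; lia.
have q_gt1 : (1 < q)%N by rewrite -hq finNzRing_gt1.
have binom_ge : (q ^ (m * (k - rho)))%:R <= gauss_binom q n rho.
  rewrite -hq -hm -dimU -(prednK rho_gt0).
  apply: spanned_by_points_gauss_binom_ge hsat.1.
  by rewrite prednK // le_rk dimU.
have exponent_lt e : gauss_binom q n rho < q%:R ^+ e -> (m * (k - rho) < e)%N.
  by move/(le_lt_trans binom_ge); rewrite -natrX ltr_nat ltn_exp2l.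
have ceil_bound (x : rat) : x <= (rho * (n - rho + m))%:R ->
    Num.ceil (x / rho%:R) - m%:Z + rho%:Z <= n%:Z.
  by rewrite -lerBrDr lerBlDr subzn // -PoszD ceil_divr_natr_le.
split=> // [q_gt2 | q2 _ | q2 rho1].
- apply: ceil_bound; rewrite ler_nat.
  by have := exponent_lt _ (gauss_binom_gt2_lt q_gt2 le_rn); nia.
- apply: ceil_bound; rewrite lerBlDr natr1 ler_nat.
  have := exponent_lt (rho * (n - rho) + 2)%N.
  by rewrite q2 gauss_binom2_lt //; nia.
- rewrite addn1 -rho1; apply: exponent_lt.
  by rewrite q2 rho1 gauss_binom1 -[2%:R - 1]/(1 : rat) divr1 ltrBlDr ltrDl.
Qed.
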